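(* Consider the linear time-varying discrete-time system with unknown inputs described in the context (with $w_k=0$, $v_k=0$, $B_k=0$, $D_k=0$). The system is strongly observable (input and state observable) if and only if, for all sufficiently large $r$ (i.e. for all $r\ge r_0$, for some $r_0\in\mathbb{N}$), $$\mathrm{rk}\begin{bmatrix}\mathcal{O}_{2,r} & \mathcal{I}_{(2,2),r}\end{bmatrix}=n+rp-\sum_{k=0}^{r-1}p_{H_k}. \qquad ( * )$$ Moreover, the following are necessary conditions for $( * )$ to hold at $r$: (I) either $r\ge r_{0,r}$ and $l\ge p+1$, where $r_{0,r}:=\left\lceil \frac{n-l-p_{H_r}}{l-p}\right\rceil$, or $l=p=n$ and $p_{H_r}=0$; (II)(a) $\mathrm{rk}(\mathcal{O}_{2,r})=n$; and (b) $\mathrm{rk}(\mathcal{I}^k_{(2,2),r})=p-p_{H_{k-1}}$ for all $1\le k\le r$, where $\mathcal{I}^k_{(2,2),r}$ is the $k$-th block column of $\mathcal{I}_{(2,2),r}$.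
   Context: System: $x_{k+1}=A_kx_k+B_ku_k+G_kd_k+w_k$, $y_k=C_kx_k+D_ku_k+H_kd_k+v_k$, $k\ge0$, with state $x_k\in\mathbb{R}^n$, known input $u_k\in\mathbb{R}^m$, unknown arbitrary input $d_k\in\mathbb{R}^p$, measurement $y_k\in\mathbb{R}^l$. The noise covariances are $Q_k=\mathbb{E}[w_kw_k^\top]\succeq0$ and $R_k=\mathbb{E}[v_kv_k^\top]\succ0$ (for observability questions the noises and the known inputs are set to zero; $R_k$ enters only through $T_k$ below). All matrices are known and bounded. Standing assumptions: $n\ge l\ge1$, $l\ge p\ge0$, $m\ge 0$, $\max_k \mathrm{rk}[G_k^\top\ H_k^\top]=p$. No assumption is made on the rank of $H_k$. Transformation: $p_{H_k}:=\mathrm{rk}(H_k)$; singular value decomposition $H_k=\begin{bmatrix}U_{1,k}&U_{2,k}\end{bmatrix}\begin{bmatrix}\Sigma_k&0\\ 0&0\end{bmatrix}\begin{bmatrix}V_{1,k}^\top\\ V_{2,k}^\top\end{bmatrix}$ with $\Sigma_k\in\mathbb{R}^{p_{H_k}\times p_{H_k}}$ diagonal of full rank, and $[U_{1,k}\ U_{2,k}]$, $[V_{1,k}\ V_{2,k}]$ unitary. Put $d_{1,k}=V_{1,k}^\top d_k$, $d_{2,k}=V_{2,k}^\top d_k$, $G_{1,k}=G_kV_{1,k}$, $G_{2,k}=G_kV_{2,k}$, $T_{1,k}=U_{1,k}^\top-U_{1,k}^\top R_kU_{2,k}(U_{2,k}^\top R_kU_{2,k})^{-1}U_{2,k}^\top$,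 $T_{2,k}=U_{2,k}^\top$, $T_k=\begin{bmatrix}T_{1,k}\\ T_{2,k}\end{bmatrix}$ (nonsingular), $C_{1,k}=T_{1,k}C_k$, $C_{2,k}=U_{2,k}^\top C_k$, $z_{1,k}=T_{1,k}y_k$, $z_{2,k}=T_{2,k}y_k$. Operations with empty matrices are allowed (the inverse of an empty matrix is empty). Set $\hat A_i:=A_i-G_{1,i}\Sigma_i^{-1}C_{1,i}$, $\Phi_{(i,i)}:=\hat A_i$, $\Phi_{(i,j)}:=\hat A_j\cdots\hat A_i$ for $j>i$. $\mathcal{O}_{2,r}\in\mathbb{R}^{((r+1)l-\sum_{k=0}^rp_{H_k})\times n}$ is the stack of $C_{2,0},\ C_{2,1}\hat A_0,\ C_{2,2}\Phi_{(0,1)},\dots,C_{2,r}\Phi_{(0,r-1)}$. $\mathcal{I}_{(2,2),r}\in\mathbb{R}^{((r+1)l-\sum_{k=0}^rp_{H_k})\times(rp-\sum_{k=0}^{r-1}p_{H_k})}$ is the block matrix with block rows $i=0,\dots,r$ and block columns $j=0,\dots,r-1$ whose $(i,j)$ block is $0$ if $i\le j$, $C_{2,j+1}G_{2,j}$ if $i=j+1$, and $C_{2,i}\Phi_{(j+1,i-1)}G_{2,j}$ if $i>j+1$. Its $k$-th block column ($1\le k\le r$) is the one with $j=k-1$. Strong observability: the system is strongly observable (equivalently, state and input observable, perfectly observable) if $x_0$ and the unknown input vector $\mathcal{D}_r$, consisting of $d_{1,0},\dots,d_{1,r}$ and $d_{2,0},\dots,d_{2,r-1}$ (so $\mathcal{D}_r\in\mathbb{R}^{rp+p_{H_r}}$),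 can be uniquely determined from the measured outputs $y_0,\dots,y_r$ (equivalently from $z_{1,0},\dots,z_{1,r},z_{2,0},\dots,z_{2,r}$) for a large enough number of observations, i.e. for $r\ge r_0$ for some $r_0\in\mathbb{N}$. $\lceil a\rceil$ is the smallest integer not less than $a$. *)

(* Defs.v *)
From mathcomp Require Import all_boot all_order all_algebra.
From mathcomp Require Import reals.

Set Implicit Arguments.
Unset Strict Implicit.
Unset Printing Implicit Defensive.

Import Order.TTheory GRing.Theory Num.Theory.
Local Open Scope ring_scope.

(* x_{k+1} = A_k x_k + B_k u_k + G_k d_k + w_k,
   y_k     = C_k x_k + D_k u_k + H_k d_k + v_k,
   with noise covariances Q_k (of w_k) and R_k (of v_k). *)
Record system (R : realType) (n m p l : nat) := System {
  sysA : nat -> 'M[R]_n;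
  sysB : nat -> 'M[R]_(n, m);
  sysC : nat -> 'M[R]_(l, n);
  sysD : nat -> 'M[R]_(l, m);
  sysG : nat -> 'M[R]_(n, p);
  sysH : nat -> 'M[R]_(l, p);
  sysQ : nat -> 'M[R]_n;
  sysR : nat -> 'M[R]_l
}.

Fixpoint state (R : realType) n m p l (S : system R n m p l)
    (u : nat -> 'cV[R]_m) (d : nat -> 'cV[R]_p) (w : nat -> 'cV[R]_n)
    (x0 : 'cV[R]_n) (k : nat) : 'cV[R]_n :=
  if k is k'.+1 then
    sysA S k' *m state S u d w x0 k' + sysB S k' *m u k' + sysG S k' *m d k'
      + w k'
  else x0.

Definition output (R : realType) n m p l (S : system R n m p l)
    (u : nat -> 'cV[R]_m) (d : nat -> 'cV[R]_p)
    (w : nat -> 'cV[R]_n) (v : nat -> 'cV[R]_l)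
    (x0 : 'cV[R]_n) (k : nat) : 'cV[R]_l :=
  sysC S k *m state S u d w x0 k + sysD S k *m u k + sysH S k *m d k + v k.

Definition bounded_mxs (R : realType) m n (F : nat -> 'M[R]_(m, n)) : Prop :=
  exists M : R, forall k i j, `|F k i j| <= M.

Definition bounded_system (R : realType) n m p l (S : system R n m p l) : Prop :=
  [/\ bounded_mxs (sysA S), bounded_mxs (sysB S),
      bounded_mxs (sysC S) & bounded_mxs (sysD S)] /\
  [/\ bounded_mxs (sysG S), bounded_mxs (sysH S),
      bounded_mxs (sysQ S) & bounded_mxs (sysR S)].

Definition psd (R : realType) n (M : 'M[R]_n) : Prop :=
  M^T = M /\ forall x : 'cV[R]_n, 0 <= (x^T *m M *m x) 0 0.

Definition posdef (R : realType) n (M : 'M[R]_n) : Prop :=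
  M^T = M /\ forall x : 'cV[R]_n, x != 0 -> 0 < (x^T *m M *m x) 0 0.

(* A matrix of type 'M_(m, n) with m and n equal but not convertible
   (as for [U_1 U_2]) can be orthogonal, hence two-sided equations. *)
Definition orthogonal_mx (R : realType) m n (M : 'M[R]_(m, n)) : Prop :=
  M *m M^T = 1%:M /\ M^T *m M = 1%:M.

Record svd (R : realType) (l p : nat) (H : 'M[R]_(l, p)) := SVD {
  svdU1 : 'M[R]_(l, \rank H);
  svdU2 : 'M[R]_(l, l - \rank H);
  svdS  : 'M[R]_(\rank H);
  svdV1 : 'M[R]_(p, \rank H);
  svdV2 : 'M[R]_(p, p - \rank H);
  svd_U_orthogonal : orthogonal_mx (row_mx svdU1 svdU2);
  svd_V_orthogonal : orthogonal_mx (row_mx svdV1 svdV2);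
  svd_S_diag : is_diag_mx svdS;
  svd_S_ge0  : forall i, 0 <= svdS i i;
  svd_S_full : \rank svdS = \rank H;
  svd_eq : H = row_mx svdU1 svdU2 *m block_mx svdS 0 0 0
               *m col_mx svdV1^T svdV2^T
}.

Definition pH (R : realType) n m p l (S : system R n m p l) (k : nat) : nat :=
  \rank (sysH S k).

Definition G1 (R : realType) n m p l (S : system R n m p l)
    (F : forall k, svd (sysH S k)) (k : nat) : 'M[R]_(n, pH S k) :=
  sysG S k *m svdV1 (F k).

Definition G2 (R : realType) n m p l (S : system R n m p l)
    (F : forall k, svd (sysH S k)) (k : nat) : 'M[R]_(n, p - pH S k) :=
  sysG S k *m svdV2 (F k).

Definition T1 (R : realType) n m p l (S : system R n m p l)
    (F : forall k, svd (sysH S k)) (k : nat) : 'M[R]_(pH S k, l) :=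
  let U1 := svdU1 (F k) in let U2 := svdU2 (F k) in
  U1^T - U1^T *m sysR S k *m U2 *m invmx (U2^T *m sysR S k *m U2) *m U2^T.

Definition T2 (R : realType) n m p l (S : system R n m p l)
    (F : forall k, svd (sysH S k)) (k : nat) : 'M[R]_(l - pH S k, l) :=
  (svdU2 (F k))^T.

Definition C1 (R : realType) n m p l (S : system R n m p l)
    (F : forall k, svd (sysH S k)) (k : nat) : 'M[R]_(pH S k, n) :=
  T1 F k *m sysC S k.

Definition C2 (R : realType) n m p l (S : system R n m p l)
    (F : forall k, svd (sysH S k)) (k : nat) : 'M[R]_(l - pH S k, n) :=
  T2 F k *m sysC S k.

Definition Ahat (R : realType) n m p l (S : system R n m p l)
    (F : forall k, svd (sysH S k)) (k : nat) : 'M[R]_n :=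
  sysA S k - G1 F k *m invmx (svdS (F k)) *m C1 F k.

(* Phi_(i,j) = Ahat_j * ... * Ahat_i, latest factor on the left;
   only used for i <= j. *)
Definition Phi (R : realType) n m p l (S : system R n m p l)
    (F : forall k, svd (sysH S k)) (i j : nat) : 'M[R]_n :=
  \big[mulmx/1%:M]_(k <- rev (index_iota i j.+1)) Ahat F k.

Definition O2_block (R : realType) n m p l (S : system R n m p l)
    (F : forall k, svd (sysH S k)) (i : nat) : 'M[R]_(l - pH S i, n) :=
  if i == 0%N then C2 F i else C2 F i *m Phi F 0 i.-1.

Definition O2 (R : realType) n m p l (S : system R n m p l)
    (F : forall k, svd (sysH S k)) (r : nat) :
    'M[R]_(\sum_(i < r.+1) (l - pH S i), n) :=
  \mxcol_(i < r.+1) O2_block F i.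

Definition I22_block (R : realType) n m p l (S : system R n m p l)
    (F : forall k, svd (sysH S k)) (i j : nat) :
    'M[R]_(l - pH S i, p - pH S j) :=
  if (i <= j)%N then 0
  else if i == j.+1 then C2 F i *m G2 F j
  else C2 F i *m Phi F j.+1 i.-1 *m G2 F j.

Definition I22 (R : realType) n m p l (S : system R n m p l)
    (F : forall k, svd (sysH S k)) (r : nat) :
    'M[R]_(\sum_(i < r.+1) (l - pH S i), \sum_(j < r) (p - pH S j)) :=
  \mxblock_(i < r.+1, j < r) I22_block F i j.

Definition d1 (R : realType) n m p l (S : system R n m p l)
    (F : forall k, svd (sysH S k)) (d : nat -> 'cV[R]_p) (k : nat) :
    'cV[R]_(pH S k) := (svdV1 (F k))^T *m d k.

Definition d2 (R : realType) n m p l (S : system R n m p l)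
    (F : forall k, svd (sysH S k)) (d : nat -> 'cV[R]_p) (k : nat) :
    'cV[R]_(p - pH S k) := (svdV2 (F k))^T *m d k.

(* In the noise-free system driven by a known input u, the outputs
   y_0, ..., y_r determine x_0, d_{1,0}, ..., d_{1,r} and
   d_{2,0}, ..., d_{2,r-1}, for all large r. *)
Definition strongly_observable (R : realType) n m p l (S : system R n m p l)
    (F : forall k, svd (sysH S k)) : Prop :=
  exists r0 : nat, forall r : nat, (r0 <= r)%N ->
  forall (u : nat -> 'cV[R]_m) (x x' : 'cV[R]_n) (d d' : nat -> 'cV[R]_p),
    (forall k, (k <= r)%N ->
       output S u d (fun=> 0) (fun=> 0) x k =
       output S u d' (fun=> 0) (fun=> 0) x' k) ->
    [/\ x = x',
        forall k, (k <= r)%N -> d1 F d k = d1 F d' k &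
        forall k, (k < r)%N -> d2 F d k = d2 F d' k].

(* The natural-number subtraction is exact because pH S k <= p. *)
Definition full_rank_at (R : realType) n m p l (S : system R n m p l)
    (F : forall k, svd (sysH S k)) (r : nat) : Prop :=
  \rank (row_mx (O2 F r) (I22 F r)) = (n + r * p - \sum_(k < r) pH S k)%N.

Definition r0_at (R : realType) n m p l (S : system R n m p l) (r : nat) : int :=
  Num.ceil ((n%:R - l%:R - (pH S r)%:R) / (l%:R - p%:R) : R).

(* Main.v *)
Require Import Defs.
From mathcomp Require Import all_boot all_order all_algebra.
From mathcomp Require Import reals.
From mathcomp Require Import zify lra.

Import Order.TTheory GRing.Theory Num.Theory.
Local Open Scope ring_scope.

(** By linearity, observability on the horizon 0, ..., r says that an input
    sequence and an initial state producing the zero output up to time r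
    vanish, as far as the output can see them ([determined_atP]).  Multiplying
    the output equation by the nonsingular matrix T splits a zero output at
    time k into two conditions ([output_eq0]): z_{2,k} = C_{2,k} x_k must be
    zero, and z_{1,k} = C_{1,k} x_k + Sigma_k d_{1,k} = 0 fixes
    d_{1,k} = - Sigma_k^{-1} C_{1,k} x_k.  Substituting this feedback into the
    state equation replaces A_k by Ahat_k and leaves d_{2,k} as the only free
    input: x_{k+1} = Ahat_k x_k + G_{2,k} d_{2,k}.

    Solving this reduced recursion explicitly shows that the block matrix
    [O_2 I_(2,2)] maps (x_0, d_{2,0}, ..., d_{2,r-1}) to the stack of the
    outputs C_{2,i} x_i for i <= r ([O2_I22_mul]).  Hence it has a trivial
    kernel exactly when the initial state and the inputs are determined, and
    a trivial kernel is full column rank, the number of columns being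
    n + r p - sum p_{H_k}.  The equivalence thus holds at each horizon r
    separately ([determined_at_full_rank]).

    The necessary conditions are consequences of full column rank alone: every
    block of columns again has full column rank, and there are at least as
    many rows as columns, which gives (r + 1) l - p_{H_r} >= n + r p. *)

(** * Full column rank *)


Lemma row_full_injP {K : fieldType} {m n : nat} (M : 'M[K]_(m, n)) :
  (forall v : 'cV_n, M *m v = 0 -> v = 0) <-> row_full M.
Proof.
split=> [inj | /row_fullP[L LM] v Mv].
  have coker0 : cokermx M = 0.
    apply/matrixP=> i j; have := inj (col j (cokermx M)).
    rewrite colE mulmxA mulmx_coker mul0mx -colE => /(_ erefl)/matrixP/(_ i 0).
    by rewrite !mxE.
  have := mxrank_coker M; rewrite coker0 mxrank0 => /esym/eqP.
  by rewrite subn_eq0 /row_full eqn_leq rank_leq_col.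
by rewrite -[v]mul1mx -LM -mulmxA Mv mulmx0.
Qed.

Lemma row_full_row_mx {K : fieldType} {m n1 n2 : nat}
    (A : 'M[K]_(m, n1)) (B : 'M[K]_(m, n2)) :
  row_full (row_mx A B) -> row_full A /\ row_full B.
Proof.
move=> /row_full_injP inj; split; apply/row_full_injP=> v v0.
  have := inj (col_mx v 0); rewrite mul_row_col v0 mulmx0 addr0.
  by move=> /(_ erefl)/(congr1 usubmx); rewrite col_mxKu linear0.
have := inj (col_mx 0 v); rewrite mul_row_col v0 mulmx0 addr0.
by move=> /(_ erefl)/(congr1 dsubmx); rewrite col_mxKd linear0.
Qed.

(** If L is a left inverse of A, the j-th block row of L is a left inverse of
    the j-th block column of A. *)
Lemma row_full_submxrow {K : fieldType} {m q : nat} {q_ : 'I_q -> nat}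
    (A : 'M[K]_(m, \sum_i q_ i)) (j : 'I_q) :
  row_full A -> row_full (submxrow A j).
Proof.
move=> /row_fullP[L LA]; apply/row_fullP; exists (submxcol L j).
rewrite submxcol_mul mul_submxrow LA -submxblockEh -mxdiagZ /mxdiag mxblockK.
by rewrite eqxx conform_mx_id.
Qed.

(** * The singular value decomposition and the output equation *)

Lemma orthogonal_row_mx {R : realType} {m a b : nat}
    {X : 'M[R]_(m, a)} {Y : 'M[R]_(m, b)} :
  orthogonal_mx (row_mx X Y) ->
  [/\ X^T *m X = 1%:M, X^T *m Y = 0, Y^T *m X = 0, Y^T *m Y = 1%:M &
      X *m X^T + Y *m Y^T = 1%:M].
Proof.
case; rewrite tr_row_mx mul_row_col mul_col_row scalar_mx_block => XY.
by move=> /eq_block_mx[].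
Qed.

Lemma svdS_unit {R : realType} {l p : nat} {H : 'M[R]_(l, p)} (f : svd H) :
  svdS f \in unitmx.
Proof. by rewrite -row_free_unit /row_free (svd_S_full f). Qed.

Lemma svd_thin {R : realType} {l p : nat} {H : 'M[R]_(l, p)} (f : svd H) :
  H = svdU1 f *m svdS f *m (svdV1 f)^T.
Proof.
by rewrite {1}(svd_eq f) mul_row_block mul_row_col !mulmx0 !addr0 mul0mx addr0.
Qed.

(** T_1 and T_2 differ from U_1^T and U_2^T by a unit triangular factor, so a
    vector killed by both is zero.  They turn H into Sigma V_1^T and 0
    respectively, which decouples the output equation. *)
Lemma output_eq0 {R : realType} {n m p l : nat} {S : system R n m p l}
    (F : forall k, svd (sysH S k)) (k : nat) (x : 'cV[R]_n) (d : 'cV[R]_p) :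
  sysC S k *m x + sysH S k *m d = 0 <->
  C2 F k *m x = 0 /\
  (svdV1 (F k))^T *m d = - (invmx (svdS (F k)) *m (C1 F k *m x)).
Proof.
have [U11 U12 U21 U22 UU] := orthogonal_row_mx (svd_U_orthogonal (F k)).
have Su := svdS_unit (F k).
have T2H : T2 F k *m sysH S k = 0.
  by rewrite {1}(svd_thin (F k)) /T2 !mulmxA U21 !mul0mx.
have T1H : T1 F k *m sysH S k = svdS (F k) *m (svdV1 (F k))^T.
  rewrite {1}(svd_thin (F k)) /T1 !mulmxA !mulmxBl U11 mul1mx.
  by rewrite -!(mulmxA _ _ (svdU1 _)) U21 !mulmx0 !mul0mx subr0.
have T1y : T1 F k *m (sysC S k *m x + sysH S k *m d) =
    C1 F k *m x + svdS (F k) *m ((svdV1 (F k))^T *m d).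
  by rewrite mulmxDr !mulmxA T1H.
have T2y : T2 F k *m (sysC S k *m x + sysH S k *m d) = C2 F k *m x.
  by rewrite mulmxDr !mulmxA T2H mul0mx addr0.
split=> [y0 | [C2x0 d1E]].
  move: T1y T2y; rewrite y0 !mulmx0 => T1y <-; split=> //.
  move/esym/eqP: T1y; rewrite addrC addr_eq0 => /eqP SdE.
  by rewrite -mulmxN -SdE mulKmx.
move: T1y T2y; rewrite d1E C2x0 mulmxN mulKVmx // subrr.
set y := _ + _; rewrite /T1 /T2 => T1y0 T2y0.
move: T1y0; rewrite mulmxBl -(mulmxA _ _ y) T2y0 mulmx0 subr0 => U1y0.
by rewrite -[y]mul1mx -UU mulmxDl -!mulmxA U1y0 T2y0 !mulmx0 addr0.
Qed.

(** * Inputs that keep the output at zero *)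

(** State of the system in which d_1 has been eliminated by the feedback that
    keeps z_1 at zero; [e] stands for d_2. *)
Fixpoint zstate {R : realType} {n m p l : nat} {S : system R n m p l}
    (F : forall k, svd (sysH S k)) (e : forall k, 'cV[R]_(p - pH S k))
    (x0 : 'cV[R]_n) (k : nat) : 'cV[R]_n :=
  if k is k'.+1 then Ahat F k' *m zstate F e x0 k' + G2 F k' *m e k'
  else x0.

Lemma zstate_step {R : realType} {n m p l : nat} {S : system R n m p l}
    (F : forall k, svd (sysH S k)) (k : nat) (x : 'cV[R]_n) (d : 'cV[R]_p) :
  (svdV1 (F k))^T *m d = - (invmx (svdS (F k)) *m (C1 F k *m x)) ->
  sysA S k *m x + sysG S k *m d =
  Ahat F k *m x + G2 F k *m ((svdV2 (F k))^T *m d).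
Proof.
move=> d1E; have [_ _ _ _ VV] := orthogonal_row_mx (svd_V_orthogonal (F k)).
rewrite -{1}[d]mul1mx -VV mulmxDl -!mulmxA d1E /Ahat /G1 /G2 mulmxBl.
by rewrite mulmxDr !mulmxN -!mulmxA addrA.
Qed.

Definition zero_output {R : realType} {n m p l : nat} (S : system R n m p l)
    (d : nat -> 'cV[R]_p) (x0 : 'cV[R]_n) (r : nat) : Prop :=
  forall k, (k <= r)%N ->
    output S (fun=> 0) d (fun=> 0) (fun=> 0) x0 k = 0.

Lemma output0E {R : realType} {n m p l : nat} (S : system R n m p l)
    (d : nat -> 'cV[R]_p) (x0 : 'cV[R]_n) (k : nat) :
  output S (fun=> 0) d (fun=> 0) (fun=> 0) x0 k =
  sysC S k *m state S (fun=> 0) d (fun=> 0) x0 k + sysH S k *m d k.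
Proof. by rewrite /output mulmx0 !addr0. Qed.

(** A zero output forces the feedback value of d_1, so the actual state follows
    the reduced recursion. *)
Lemma zero_output_zstate {R : realType} {n m p l : nat}
    {S : system R n m p l} (F : forall k, svd (sysH S k))
    {d : nat -> 'cV[R]_p} {x0 : 'cV[R]_n} {r : nat} :
  zero_output S d x0 r ->
  forall k, (k <= r)%N ->
  [/\ state S (fun=> 0) d (fun=> 0) x0 k = zstate F (d2 F d) x0 k,
      C2 F k *m zstate F (d2 F d) x0 k = 0 &
      d1 F d k =
        - (invmx (svdS (F k)) *m (C1 F k *m zstate F (d2 F d) x0 k))].
Proof.
move=> y0 k le_kr.
have stE : state S (fun=> 0) d (fun=> 0) x0 k = zstate F (d2 F d) x0 k.
  elim: k le_kr => //= k IHk lt_kr; have /IHk stE := ltnW lt_kr.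
  have := y0 k (ltnW lt_kr); rewrite output0E => /(output_eq0 F)[_ d1E].
  by rewrite mulmx0 !addr0 (zstate_step F) // stE.
by have := y0 k le_kr; rewrite output0E stE => /(output_eq0 F)[].
Qed.

(** The input whose d_2 part is [e] and whose d_1 part is the feedback keeping
    z_1 at zero along the reduced trajectory. *)
Definition zeroing_input {R : realType} {n m p l : nat}
    {S : system R n m p l} (F : forall k, svd (sysH S k))
    (e : forall k, 'cV[R]_(p - pH S k)) (x0 : 'cV[R]_n) (k : nat) :
    'cV[R]_p :=
  svdV2 (F k) *m e k
  - svdV1 (F k) *m (invmx (svdS (F k)) *m (C1 F k *m zstate F e x0 k)).

Lemma d1_zeroing_input {R : realType} {n m p l : nat}
    {S : system R n m p l} (F : forall k, svd (sysH S k))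
    (e : forall k, 'cV[R]_(p - pH S k)) (x0 : 'cV[R]_n) (k : nat) :
  d1 F (zeroing_input F e x0) k =
  - (invmx (svdS (F k)) *m (C1 F k *m zstate F e x0 k)).
Proof.
have [V11 V12 _ _ _] := orthogonal_row_mx (svd_V_orthogonal (F k)).
by rewrite /d1 mulmxBr !mulmxA V12 V11 mul0mx mul1mx sub0r.
Qed.

Lemma d2_zeroing_input {R : realType} {n m p l : nat}
    {S : system R n m p l} (F : forall k, svd (sysH S k))
    (e : forall k, 'cV[R]_(p - pH S k)) (x0 : 'cV[R]_n) (k : nat) :
  d2 F (zeroing_input F e x0) k = e k.
Proof.
have [_ _ V21 V22 _] := orthogonal_row_mx (svd_V_orthogonal (F k)).
by rewrite /d2 mulmxBr !mulmxA V21 V22 !mul0mx mul1mx subr0.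
Qed.

(** Converse of [zero_output_zstate]: once z_1 is kept at zero by feedback, only
    the outputs z_2 of the reduced trajectory remain to be zero. *)
Lemma zeroing_inputP {R : realType} {n m p l : nat}
    {S : system R n m p l} (F : forall k, svd (sysH S k))
    (e : forall k, 'cV[R]_(p - pH S k)) (x0 : 'cV[R]_n) (r : nat) :
  (forall k, (k <= r)%N -> C2 F k *m zstate F e x0 k = 0) ->
  zero_output S (zeroing_input F e x0) x0 r.
Proof.
move=> z0 k le_kr; rewrite output0E.
have -> : state S (fun=> 0) (zeroing_input F e x0) (fun=> 0) x0 k =
    zstate F e x0 k.
  elim: k {le_kr} => //= k IHk.
  rewrite mulmx0 !addr0 IHk (zstate_step F); last exact: d1_zeroing_input.
  by congr (_ + _ *m _); apply: d2_zeroing_input.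
by apply/(output_eq0 F); split; [exact: z0 | exact: d1_zeroing_input].
Qed.

(** * The matrix [O_2 I_(2,2)] as an output map *)

(** Transition matrix of the reduced recursion from time i to time j, that is
    Phi_(i, j-1).  The half-open range makes it the identity for i = j, which
    absorbs the special cases in the blocks of O_2 and I_(2,2). *)
Definition propagator {R : realType} {n m p l : nat} {S : system R n m p l}
    (F : forall k, svd (sysH S k)) (i j : nat) : 'M[R]_n :=
  \big[mulmx/1%:M]_(k <- rev (index_iota i j)) Ahat F k.

Lemma propagatorS {R : realType} {n m p l : nat} {S : system R n m p l}
    (F : forall k, svd (sysH S k)) (i j : nat) : (i <= j)%N ->
  propagator F i j.+1 = Ahat F j *m propagator F i j.
Proof.
move=> le_ij; rewrite /propagator /index_iota subSn // -addn1 iotaD rev_cat.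
by rewrite subnKC //= big_cons.
Qed.

Lemma propagator_id {R : realType} {n m p l : nat} {S : system R n m p l}
    (F : forall k, svd (sysH S k)) (i : nat) : propagator F i i = 1%:M.
Proof. by rewrite /propagator /index_iota subnn big_nil. Qed.

Lemma zstateE {R : realType} {n m p l : nat} {S : system R n m p l}
    (F : forall k, svd (sysH S k)) (e : forall k, 'cV[R]_(p - pH S k))
    (x0 : 'cV[R]_n) (k : nat) :
  zstate F e x0 k = propagator F 0 k *m x0
    + \sum_(0 <= j < k) propagator F j.+1 k *m (G2 F j *m e j).
Proof.
elim: k => [|k IHk] /=; first by rewrite propagator_id mul1mx big_geq // addr0.
rewrite big_nat_recr //= propagator_id mul1mx addrA IHk mulmxDr !mulmxA.
rewrite -propagatorS // mulmx_sumr; congr (_ + _ + _).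
apply: eq_big_nat => j /andP[_ lt_jk].
by rewrite mulmxA -propagatorS // -mulmxA.
Qed.

Lemma O2_blockE {R : realType} {n m p l : nat} {S : system R n m p l}
    (F : forall k, svd (sysH S k)) (i : nat) :
  O2_block F i = C2 F i *m propagator F 0 i.
Proof. by case: i => [|i]; rewrite /O2_block //= propagator_id mulmx1. Qed.

Lemma I22_blockE {R : realType} {n m p l : nat} {S : system R n m p l}
    (F : forall k, svd (sysH S k)) (i j : nat) :
  I22_block F i j =
  if (j < i)%N then C2 F i *m propagator F j.+1 i *m G2 F j else 0.
Proof.
rewrite /I22_block leqNgt; case: ltnP => //= lt_ji.
case: eqP => [-> | _]; first by rewrite propagator_id mulmx1.
by case: i lt_ji.
Qed.

(** The bridge between the rank condition and the dynamics: variation of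
    constants, read off block row by block row. *)
Lemma O2_I22_mul {R : realType} {n m p l : nat} {S : system R n m p l}
    (F : forall k, svd (sysH S k)) (e : forall k, 'cV[R]_(p - pH S k))
    (x0 : 'cV[R]_n) (r : nat) :
  row_mx (O2 F r) (I22 F r) *m col_mx x0 (\mxcol_(j < r) e j) =
  \mxcol_(i < r.+1) (C2 F i *m zstate F e x0 i).
Proof.
rewrite mul_row_col /O2 mxcol_mul /I22 mul_mxblock_mxrow -mxcolD.
apply/eq_mxcolP => i; rewrite zstateE mulmxDr O2_blockE mulmxA; congr (_ + _).
have le_ir : (i <= r)%N by rewrite -ltnS.
transitivity (\sum_(0 <= j < r) I22_block F i j *m e j).
  by rewrite big_mkord.
rewrite (big_cat_nat _ le_ir) //= [X in _ + X]big_nat_cond.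
rewrite [X in _ + X]big1 => [|j].
  rewrite addr0 mulmx_sumr; apply: eq_big_nat => j /andP[_ lt_ji].
  by rewrite I22_blockE lt_ji !mulmxA.
by rewrite andbT => /andP[le_ij _]; rewrite I22_blockE ltnNge le_ij mul0mx.
Qed.

(** Reads the blocks of a stacked vector as an input sequence.  The value 0
    beyond the horizon is harmless, because the outputs up to time r depend
    on d_2 at times before r only. *)
Definition extend_input {R : realType} {n m p l : nat}
    {S : system R n m p l} {r : nat}
    (v : 'cV[R]_(\sum_(j < r) (p - pH S j))) (k : nat) :
    'cV[R]_(p - pH S k) :=
  match ltnP k r with
  | LtnNotGeq lt_kr => submxcol v (Ordinal lt_kr)
  | _ => 0
  end.

Lemma extend_inputK {R : realType} {n m p l : nat}
    {S : system R n m p l} {r : nat}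
    (v : 'cV[R]_(\sum_(j < r) (p - pH S j))) :
  \mxcol_(j < r) extend_input v j = v.
Proof.
rewrite -[RHS]submxcolK; apply/eq_mxcolP => -[k lt_kr].
rewrite /extend_input /=; case: ltnP => [lt_kr' | ].
  by rewrite (bool_irrelevance lt_kr lt_kr').
by rewrite leqNgt lt_kr.
Qed.

(** * Observability and full rank at a fixed horizon *)

Lemma sum_subn_const (r q : nat) (f : nat -> nat) :
  (forall k, (f k <= q)%N) ->
  (\sum_(k < r) (q - f k) + \sum_(k < r) f k = r * q)%N.
Proof.
move=> le_fq; rewrite -big_split /= (eq_bigr (fun=> q)) => [|k _].
  by rewrite sum_nat_const card_ord.
exact: subnK.
Qed.

Lemma full_rankE {R : realType} {n m p l : nat} {S : system R n m p l}
    (F : forall k, svd (sysH S k)) (r : nat) :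
  full_rank_at F r <-> row_full (row_mx (O2 F r) (I22 F r)).
Proof.
have le_pH k : (pH S k <= p)%N := rank_leq_col _.
have cnt := sum_subn_const r p (pH S) le_pH.
rewrite /full_rank_at -cnt addnA addnK.
by split=> /eqP.
Qed.

(** The requirement that strong observability imposes on each large r. *)
Definition determined_at {R : realType} {n m p l : nat}
    {S : system R n m p l} (F : forall k, svd (sysH S k)) (r : nat) : Prop :=
  forall (u : nat -> 'cV[R]_m) (x x' : 'cV[R]_n) (d d' : nat -> 'cV[R]_p),
    (forall k, (k <= r)%N ->
       output S u d (fun=> 0) (fun=> 0) x k =
       output S u d' (fun=> 0) (fun=> 0) x' k) ->
    [/\ x = x',
        forall k, (k <= r)%N -> d1 F d k = d1 F d' k &
        forall k, (k < r)%N -> d2 F d k = d2 F d' k].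

Lemma stateB {R : realType} {n m p l : nat} (S : system R n m p l)
    (u : nat -> 'cV[R]_m) (x x' : 'cV[R]_n) (d d' : nat -> 'cV[R]_p) (k : nat) :
  state S u d (fun=> 0) x k - state S u d' (fun=> 0) x' k =
  state S (fun=> 0) (fun i => d i - d' i) (fun=> 0) (x - x') k.
Proof.
elim: k => //= k <-; rewrite mulmx0 !addr0 !mulmxBr.
rewrite [X in X - _]addrAC [X in _ - X]addrAC opprD addrACA subrr addr0.
by rewrite opprD addrACA.
Qed.

Lemma determined_atP {R : realType} {n m p l : nat}
    {S : system R n m p l} (F : forall k, svd (sysH S k)) (r : nat) :
  determined_at F r <->
  forall (x0 : 'cV[R]_n) (d : nat -> 'cV[R]_p), zero_output S d x0 r ->
    [/\ x0 = 0, forall k, (k <= r)%N -> d1 F d k = 0 &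
        forall k, (k < r)%N -> d2 F d k = 0].
Proof.
have state0 k : state S (fun=> 0) (fun=> 0) (fun=> 0) 0 k = 0.
  by elim: k => //= k ->; rewrite !mulmx0 !addr0.
split=> [det x0 d y0 | det u x x' d d' yE].
  have [|-> d1E d2E] := det (fun=> 0) x0 0 d (fun=> 0).
    by move=> k le_kr; rewrite y0 // output0E state0 !mulmx0 addr0.
  split=> // k lt_kr; first by rewrite d1E // /d1 mulmx0.
  by rewrite d2E // /d2 mulmx0.
have [|/subr0_eq xE d1E d2E] := det (x - x') (fun i => d i - d' i).
  move=> k le_kr; rewrite output0E -(stateB S u) !mulmxBr addrACA -opprD.
  rewrite -(subrr (output S u d' (fun=> 0) (fun=> 0) x' k)).
  rewrite -{1}(yE k le_kr) /output !addr0.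
  rewrite [X in _ = X - _]addrAC [X in _ = _ - X]addrAC.
  by rewrite [in RHS]opprD [RHS]addrACA subrr addr0.
split=> // k lt_kr; apply/subr0_eq.
  by rewrite -mulmxBr; apply: d1E.
by rewrite -mulmxBr; apply: d2E.
Qed.

(** A kernel vector of [O_2 I_(2,2)] is an initial state with a d_2 sequence
    whose zeroing input yields zero output; conversely a zero output gives the
    kernel vector formed by x_0 and its d_2 sequence. *)
Lemma determined_at_full_rank {R : realType} {n m p l : nat}
    {S : system R n m p l} (F : forall k, svd (sysH S k)) (r : nat) :
  determined_at F r <-> full_rank_at F r.
Proof.
rewrite determined_atP full_rankE -row_full_injP; split=> [det v | inj x0 d y0].
  rewrite -[v]vsubmxK; set x0 := usubmx v.
  rewrite -[dsubmx v]extend_inputK; set e := extend_input _.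
  rewrite O2_I22_mul => Mv0.
  have [|x0E _ d2E] := det x0 (zeroing_input F e x0).
    apply: zeroing_inputP => k le_kr; have lt_kr : (k < r.+1)%N by [].
    have := congr1 (fun w => submxcol w (Ordinal lt_kr)) Mv0.
    by rewrite mxcolK submxcol0.
  rewrite x0E (_ : \mxcol_j _ = 0) ?col_mx0 //.
  rewrite -mxcol0; apply/eq_mxcolP => j.
  by rewrite -(d2_zeroing_input F e x0) d2E.
have zP := zero_output_zstate F y0.
have Mv0 : row_mx (O2 F r) (I22 F r) *m
    col_mx x0 (\mxcol_(j < r) d2 F d j) = 0.
  rewrite O2_I22_mul -mxcol0; apply/eq_mxcolP => i.
  by have [|_ ->] := zP i; rewrite -1?ltnS.
have /eqP := inj _ Mv0; rewrite col_mx_eq0 => /andP[/eqP x0E /eqP d2E].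
have d2E' k : (k < r)%N -> d2 F d k = 0.
  move=> lt_kr; have := congr1 (fun w => submxcol w (Ordinal lt_kr)) d2E.
  by rewrite mxcolK submxcol0.
(* With x_0 and d_2 zero the reduced state stays zero, and the feedback
   formula then makes d_1 zero up to and including time r. *)
have z0 k : (k <= r)%N -> zstate F (d2 F d) x0 k = 0.
  elim: k => //= k IHk lt_kr.
  by rewrite IHk ?d2E' ?mulmx0 ?addr0 // ltnW.
split=> // k le_kr; have [//|_ _ ->] := zP k.
by rewrite z0 // !mulmx0 oppr0.
Qed.

(** A matrix of full column rank has at least as many rows as columns. *)
Lemma full_rank_count {R : realType} {n m p l : nat} {S : system R n m p l}
    (F : forall k, svd (sysH S k)) (r : nat) :
  full_rank_at F r -> (n + r * p + pH S r <= r.+1 * l)%N.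
Proof.
move=> /full_rankE/eqP rk; have := rank_leq_row (row_mx (O2 F r) (I22 F r)).
have le_pHp k : (pH S k <= p)%N := rank_leq_col _.
have le_pHl k : (pH S k <= l)%N := rank_leq_row _.
rewrite rk; have := sum_subn_const r p (pH S) le_pHp.
have := sum_subn_const r.+1 l (pH S) le_pHl.
rewrite [X in (_ + X)%N]big_ord_recr /=; lia.
Qed.

Theorem theorem2 (R : realType) (n m p l : nat) (S : system R n m p l)
    (F : forall k : nat, svd (sysH S k))
    (l_ge1 : (1 <= l)%N) (l_le_n : (l <= n)%N) (p_le_l : (p <= l)%N)
    (S_bounded : bounded_system S)
    (Q_psd : forall k : nat, psd (sysQ S k))
    (R_posdef : forall k : nat, posdef (sysR S k))
    (rank_GH_le : forall k : nat,
       (\rank (row_mx (sysG S k)^T (sysH S k)^T) <= p)%N)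
    (rank_GH_max : exists k : nat,
       \rank (row_mx (sysG S k)^T (sysH S k)^T) = p)
    (B_eq0 : forall k : nat, sysB S k = 0)
    (D_eq0 : forall k : nat, sysD S k = 0) :
  (strongly_observable F <->
     exists r0 : nat, forall r : nat, (r0 <= r)%N -> full_rank_at F r) /\
  (forall r : nat, full_rank_at F r ->
     [/\ ((r0_at S r <= r%:Z) /\ (p + 1 <= l)%N) \/
         [/\ l = p, p = n & pH S r = 0%N],
         \rank (O2 F r) = n &
         (* the k-th block column, 1 <= k <= r, has index j = k - 1 *)
         forall j : 'I_r, \rank (submxrow (I22 F r) j) = (p - pH S j)%N]).
Proof.
split=> [|r fr].
  by split=> -[r0 H]; exists r0 => r /H /(determined_at_full_rank F r).
have cnt := full_rank_count F r fr.
have /row_full_row_mx[/eqP O2full I22full] := iffLR (full_rankE F r) fr.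
split=> // [|j]; last by apply/eqP; exact: row_full_submxrow.
case: (ltnP p l) => [lt_pl | le_lp]; [left | right].
  split; last by rewrite addn1.
  (* The count gives r (l - p) >= n - l + p_{H_r}, which is at least the
     numerator n - l - p_{H_r} of the bound. *)
  have lp_gt0 : 0 < l%:R - p%:R :> R by rewrite subr_gt0 ltr_nat.
  rewrite /r0_at ceil_le_int ler_pdivrMr //.
  move: cnt; rewrite mulSn -(ler_nat R) !natrD !natrM.
  have := ler0n R (pH S r); rewrite -pmulrn; lra.
(* When l = p the count reads n + p_{H_r} <= l, against l <= n. *)
have lp : l = p by apply/eqP; rewrite eqn_leq le_lp.
have := congr1 (muln r) lp; move: cnt; rewrite mulSn; split; lia.
Qed.
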